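(* Suppose the random vector $X_1\in\mathbb R^p$ follows an elliptical model with a positive definite covariance matrix $\Sigma$; that is, $X_1=MZ_1$, where $M\in\mathbb S^{p\times p}$ is non-random and positive semidefinite, and $Z_1\in\mathbb R^p$ is a random vector with $\mathbf E(Z_1Z_1^\top)=I$ and such that $QZ_1$ and $Z_1$ have the same distribution for every non-random orthogonal matrix $Q\in\mathbb R^{p\times p}$. Let $\Sigma=\sum_{j=1}^p\lambda_j(\Sigma)\phi_j\phi_j^\top$ be the spectral decomposition with $\lambda_1(\Sigma)\ge\cdots\ge\lambda_p(\Sigma)$ and orthonormal $\phi_1,\dots,\phi_p$, and let $\zeta_{1j}=\langle X_1,\phi_j\rangle/\|\langle X_1,\phi_j\rangle\|_{L^2}$. Then: (1) If $\sup_{q\ge2}q^{-\nu}\|Z_{11}\|_{L^q}\lesssim1$ for some constant $\nu>0$ not depending on $n$ (where $Z_{11}$ is the first coordinate of $Z_1$), then there is a parameter $\nu'>0$, fixed with respect to $n$, such that $\sup_{1\le j\le p}\sup_{q\ge2}q^{-\nu'}\|\zeta_{1j}\|_{L^q}\lesssim1$. (2) If $\mathbf P(Z_1=0)=0$ and $\mathrm{var}(\|Z_1\|_2^2)\asymp\mathbf E(\|Z_1\|_2^2)$, then $$1\lesssim\inf_{1\le d\le p}\lambda_{\min}(\mathsf J_d)\le\sup_{1\le d\le p}\lambda_{\max}(\mathsf J_d)\lesssim1,$$ where $\mathsf J_d:\mathbb S^{d\times d}\to\mathbb S^{d\times d}$ is the covariance operator of the random matrix $(\zeta_{11},\dots,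\zeta_{1d})(\zeta_{11},\dots,\zeta_{1d})^\top$.
   Context: The models form a sequence indexed by $n$; the dimension $p$, the matrix $M$ and the distribution of $Z_1$ may all vary with $n$, and the size of $p$ relative to $n$ is unconstrained. For sequences of non-negative numbers, $a_n\lesssim b_n$ means that there is a constant $c>0$ not depending on $n$ (hence not on $p$) such that $a_n\le c\,b_n$ for all large $n$; $a_n\asymp b_n$ means $a_n\lesssim b_n$ and $b_n\lesssim a_n$. $\|U\|_{L^q}=(\mathbf E|U|^q)^{1/q}$, and $\|\cdot\|_2$ is the Euclidean norm. $\mathbb S^{d\times d}$ is the Hilbert space of real symmetric $d\times d$ matrices with inner product $\langle\!\langle A,B\rangle\!\rangle=\mathrm{tr}(AB)$. The covariance operator of a random element $W$ of $\mathbb S^{d\times d}$ is the linear operator $\mathsf K$ on $\mathbb S^{d\times d}$ satisfying $\langle\!\langle A,\mathsf K(B)\rangle\!\rangle=\mathrm{cov}(\langle\!\langle A,W\rangle\!\rangle,\langle\!\langle B,W\rangle\!\rangle)$ for all $A,B$; $\lambda_{\min},\lambda_{\max}$ denote its smallest and largest eigenvalues. Vectors written $(\zeta_{11},\dots,\zeta_{1d})$ are column vectors. *)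

(* Defs.v *)
From HB Require Import structures.
From mathcomp Require Import all_boot all_order all_algebra.
From mathcomp Require Import all_classical all_reals all_analysis.
Set Implicit Arguments.
Unset Strict Implicit.
Unset Printing Implicit Defensive.
Import Order.TTheory GRing.Theory Num.Theory.
Import numFieldNormedType.Exports.
Local Open Scope classical_set_scope.
Local Open Scope ring_scope.

(* \bar R-valued, since norms, variances and suprema may be infinite for some n;
   a bound by a finite b then forces a n to be finite for all large n. *)
Definition lesssim (R : realType) (a b : nat -> \bar R) : Prop :=
  exists c : R, 0 < c /\ \forall n \near \oo, (a n <= c%:E * b n)%E.

Definition asymp_eq (R : realType) (a b : nat -> \bar R) : Prop :=
  lesssim a b /\ lesssim b a.

Definition dotv (R : realType) (k : nat) (u v : 'cV[R]_k) : R :=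
  \sum_(i < k) u i ord0 * v i ord0.

(* The canonical norm of 'cV[R]_k in the library is the sup norm. *)
Definition norm2 (R : realType) (k : nat) (v : 'cV[R]_k) : R :=
  Num.sqrt (dotv v v).

Definition psdmx (R : realType) (k : nat) (A : 'M[R]_k) : Prop :=
  A^T = A /\ forall v : 'cV[R]_k, 0 <= dotv v (A *m v).

Definition pdmx (R : realType) (k : nat) (A : 'M[R]_k) : Prop :=
  A^T = A /\ forall v : 'cV[R]_k, v != 0 -> 0 < dotv v (A *m v).

Definition orthogonalmx (R : realType) (k : nat) (Q : 'M[R]_k) : Prop :=
  Q^T *m Q = 1%:M /\ Q *m Q^T = 1%:M.

Definition borel_cV (R : realType) (k : nat) :=
  g_sigma_algebraType (@open 'cV[R]_k).

Definition random_vector (d : measure_display) (T : measurableType d)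
    (R : realType) (k : nat) (Z : T -> 'cV[R]_k) : Prop :=
  measurable_fun setT (Z : T -> borel_cV R k).

Definition same_law (d : measure_display) (T : measurableType d)
    (R : realType) (P : probability T R) (k : nat) (Y Z : T -> 'cV[R]_k) : Prop :=
  forall A : set (borel_cV R k), measurable A -> P (Y @^-1` A) = P (Z @^-1` A).

(* Meaningful when the entries of X are square-integrable. *)
Definition covmx (d : measure_display) (T : measurableType d) (R : realType)
    (P : probability T R) (k : nat) (X : T -> 'cV[R]_k) : 'M[R]_k :=
  \matrix_(i, j) fine (covariance P (fun w => X w i ord0) (fun w => X w j ord0)).

Definition symv (R : realType) (d : nat) : {vspace 'M[R]_d} :=
  lker (\1 - linfun (@trmx R d d))%VF.

Lemma symvP (R : realType) (d : nat) (A : 'M[R]_d) :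
  reflect (A^T = A) (A \in symv R d).
Proof.
rewrite memv_ker add_lfunE opp_lfunE id_lfunE lfunE /= subr_eq0 eq_sym.
exact: eqP.
Qed.

Definition symmx (R : realType) (d : nat) := subvs_of (symv R d).

Definition dotS (R : realType) (d : nat) (A B : symmx R d) : R :=
  \tr (vsval A *m vsval B).

Lemma outer_symv (R : realType) (d : nat) (z : 'cV[R]_d) :
  z *m z^T \in symv R d.
Proof. by apply/symvP; rewrite trmx_mul trmxK. Qed.

Definition outer (R : realType) (d : nat) (z : 'cV[R]_d) : symmx R d :=
  Subvs (outer_symv z).

(* Since [covariance] is extended-real-valued, taking A = B shows that this can
   only hold when every <<A, W>> is square-integrable. *)
Definition is_covop (disp : measure_display) (T : measurableType disp)
    (R : realType) (P : probability T R) (d : nat) (W : T -> symmx R d)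
    (K : 'End(symmx R d)) : Prop :=
  forall A B : symmx R d,
    (dotS A (K B))%:E
    = covariance P (fun w => dotS A (W w)) (fun w => dotS B (W w)).

(* The operator characterised by [is_covop], which is unique when it exists;
   0 by convention when the second moments of W are infinite. *)
Definition covop (disp : measure_display) (T : measurableType disp)
    (R : realType) (P : probability T R) (d : nat) (W : T -> symmx R d) :
    'End(symmx R d) :=
  xget 0 [set K | is_covop P W K].

Definition lambda_min (R : realType) (d : nat) (K : 'End(symmx R d)) : \bar R :=
  ereal_inf [set a%:E | a in [set a : R | passmx.leigenvalue K a]].

Definition lambda_max (R : realType) (d : nat) (K : 'End(symmx R d)) : \bar R :=
  ereal_sup [set a%:E | a in [set a : R | passmx.leigenvalue K a]].

Definition sup_moments (disp : measure_display) (T : measurableType disp)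
    (R : realType) (P : probability T R) (nu : R) (U : T -> R) : \bar R :=
  ereal_sup [set ((q `^ (- nu))%:E * 'N[P]_(q%:E) [EFin \o U])%E
            | q in [set q : R | 2 <= q]].

Definition zeta (disp : measure_display) (T : measurableType disp)
    (R : realType) (P : probability T R) (k : nat) (X : T -> 'cV[R]_k)
    (phi : 'I_k -> 'cV[R]_k) (j : 'I_k) (w : T) : R :=
  dotv (X w) (phi j)
  / fine ('N[P]_(2%:E) [EFin \o (fun w' => dotv (X w') (phi j))])%E.

Definition zetavec (disp : measure_display) (T : measurableType disp)
    (R : realType) (P : probability T R) (k : nat) (X : T -> 'cV[R]_k)
    (phi : 'I_k -> 'cV[R]_k) (d : nat) (hd : (d <= k)%N) (w : T) : 'cV[R]_d :=
  \col_(i < d) zeta P X phi (widen_ord hd i) w.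

Definition Jop (disp : measure_display) (T : measurableType disp)
    (R : realType) (P : probability T R) (k : nat) (X : T -> 'cV[R]_k)
    (phi : 'I_k -> 'cV[R]_k) (d : nat) (hd : (d <= k)%N) : 'End(symmx R d) :=
  covop P (fun w => outer (zetavec P X phi hd w)).

Definition inf_lambda_min (disp : measure_display) (T : measurableType disp)
    (R : realType) (P : probability T R) (k : nat) (X : T -> 'cV[R]_k)
    (phi : 'I_k -> 'cV[R]_k) : \bar R :=
  ereal_inf [set y | exists (d : nat) (hd : (d <= k)%N),
    (1 <= d)%N /\ y = lambda_min (Jop P X phi hd)].

Definition sup_lambda_max (disp : measure_display) (T : measurableType disp)
    (R : realType) (P : probability T R) (k : nat) (X : T -> 'cV[R]_k)
    (phi : 'I_k -> 'cV[R]_k) : \bar R :=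
  ereal_sup [set y | exists (d : nat) (hd : (d <= k)%N),
    (1 <= d)%N /\ y = lambda_max (Jop P X phi hd)].

(* Main.v *)
Require Import Defs.
From HB Require Import structures.
From mathcomp Require Import all_boot all_order all_algebra.
From mathcomp Require Import all_classical all_reals all_analysis.
From mathcomp Require Import measurable_realfun ring lra.
Set Implicit Arguments.
Unset Strict Implicit.
Unset Printing Implicit Defensive.
Import Order.TTheory GRing.Theory Num.Theory.
Import numFieldNormedType.Exports.
Local Open Scope classical_set_scope.
Local Open Scope ring_scope.

(** Write X = M Z and let u_j = M^T phi_j. Since Sigma = M M^T and
    Sigma phi_j = lambda_j phi_j, the vectors e_j = u_j / sqrt(lambda_j) are
    orthonormal, and zeta_j = <Z, e_j> ([zeta_whitening]). Everything is then a
    statement about the rotation-invariant vector Z alone.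

    Any two vectors of the same length are exchanged by a Householder
    reflection, so the law of <Z, u> depends on u only through its length
    ([proj_integral]). In particular each zeta_j has the law of Z_1, which is
    part (1), with nu' = nu.

    For part (2), the same fact gives E <Z, u>^4 = E(Z_1^4) |u|^4 for every u.
    Writing E(Z_1^4) = 3 m and polarising, one gets the Gaussian-like formula
      E <Z,u><Z,v><Z,x><Z,y>
        = m (<u,v><x,y> + <u,x><v,y> + <u,y><v,x>)       ([proj_mean1111]).
    Hence, for the outer product W of the first d coordinates of zeta,
      cov(<<A, W>>, <<B, W>>) = 2 m <<A, B>> + (m - 1) tr A tr B
    ([quadratic_covariance]), so that J_d B = 2 m B + (m - 1) (tr B) I.
    With d = p and A = B = I this also computes the variance
    V = 2 m p + (m - 1) p^2 of |Z|^2. Eliminating m - 1, an eigenvalue a with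
    eigenvector B satisfies
      a |B|^2 = 2 m (|B|^2 - (tr B)^2 / p) + (V / p) (tr B)^2 / p,
    and (tr B)^2 <= d |B|^2 <= p |B|^2. So a is a convex combination of 2 m and
    V / p ([rotation_eigenvalue_bounds]). By assumption V / p is bounded above
    and away from 0, and m (p^2 + 2 p) = V + p^2 bounds m in the same way.
    The resulting bounds do not involve d, which gives uniformity in d. *)

(** * Dot products and Householder reflections *)

Section DotProduct.
Context {R : realType} {k : nat}.
Implicit Types u v w : 'cV[R]_k.

Lemma dotvE u v : dotv u v = (u^T *m v) ord0 ord0.
Proof. by rewrite mxE; apply: eq_bigr => i _; rewrite mxE. Qed.

Lemma dotvC u v : dotv u v = dotv v u.
Proof. by apply: eq_bigr => i _; rewrite mulrC. Qed.

Lemma dotvDr u v w : dotv u (v + w) = dotv u v + dotv u w.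
Proof. by rewrite !dotvE mulmxDr mxE. Qed.

Lemma dotvZr a u v : dotv u (a *: v) = a * dotv u v.
Proof. by rewrite !dotvE -scalemxAr mxE. Qed.

Lemma dotvNr u v : dotv u (- v) = - dotv u v.
Proof. by rewrite -scaleN1r dotvZr mulN1r. Qed.

Lemma dotvDl u v w : dotv (v + w) u = dotv v u + dotv w u.
Proof. by rewrite dotvC dotvDr !(dotvC u). Qed.

Lemma dotvZl a u v : dotv (a *: v) u = a * dotv v u.
Proof. by rewrite dotvC dotvZr dotvC. Qed.

Lemma dotvNl u v : dotv (- v) u = - dotv v u.
Proof. by rewrite dotvC dotvNr dotvC. Qed.

Definition dotv_lin := (dotvDr, dotvDl, dotvNr, dotvNl, dotvZr, dotvZl).

Lemma dotv_ge0 u : 0 <= dotv u u.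
Proof. by apply: sumr_ge0 => i _; rewrite -expr2 sqr_ge0. Qed.

Lemma dotv_eq0 u : (dotv u u == 0) = (u == 0).
Proof.
apply/eqP/eqP => [u0|->]; last by rewrite dotvE mulmx0 mxE.
apply/matrixP => i j; rewrite ord1 mxE.
have /eqP := u0; rewrite psumr_eq0 => [|l _]; last by rewrite -expr2 sqr_ge0.
by move=> /allP/(_ i (mem_index_enum _)) /=; rewrite -expr2 sqrf_eq0 => /eqP.
Qed.

Lemma dotv_delta u i : dotv u (delta_mx i ord0) = u i ord0.
Proof.
rewrite /dotv (bigD1 i)//= mxE !eqxx mulr1 big1 ?addr0// => j ji.
by rewrite mxE (negbTE ji) mulr0.
Qed.

Lemma coord_dotv (T : Type) (Z : T -> 'cV[R]_k) i :
  (fun w : T => Z w i ord0) = (fun w : T => dotv (Z w) (delta_mx i ord0)).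
Proof. by apply/funext => w; rewrite dotv_delta. Qed.

(** For v = 0 the coefficient 2 / 0 is 0 and the reflection is the identity, so
    the properties below hold for every v. *)
Definition householder v : 'M[R]_k := 1%:M - (2 / dotv v v) *: (v *m v^T).

Lemma householderE v u :
  householder v *m u = u - (2 / dotv v v * dotv v u) *: v.
Proof.
rewrite mulmxBl mul1mx -scalemxAl -mulmxA [v^T *m u]mx11_scalar -dotvE.
by rewrite mul_mx_scalar scalerA.
Qed.

Lemma householderT v : (householder v)^T = householder v.
Proof. by rewrite linearB linearZ /= trmx_mul trmxK trmx1. Qed.

Lemma householder_orthogonal v : orthogonalmx (householder v).
Proof.
suff hh : householder v *m householder v = 1%:M by rewrite /orthogonalmx householderT.
have hhK u : householder v *m (householder v *m u) = u.
  rewrite !householderE !dotv_lin.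
  have [->|v0] := eqVneq (dotv v v) 0.
    by rewrite invr0 !(mulr0, mul0r, scale0r, subr0).
  rewrite -addrA -opprD -scalerDl.
  set c := dotv v u.
  suff -> : 2 / dotv v v * c + 2 / dotv v v * (c - 2 / dotv v v * c * dotv v v) = 0.
    by rewrite scale0r subr0.
  by field.
apply/matrixP => i j; have := hhK (delta_mx j ord0).
by rewrite mulmxA -colE => /matrixP/(_ i ord0); rewrite !mxE andbT.
Qed.

(** Reflecting in the hyperplane orthogonal to [u - v] swaps two vectors of the
    same length. *)
Lemma householder_swap u v :
  dotv u u = dotv v v -> householder (u - v) *m u = v.
Proof.
move=> uv; rewrite householderE.
have [->|d0] := eqVneq u v; first by rewrite subrr scaler0 subr0.
have {}d0 : dotv (u - v) (u - v) != 0 by rewrite dotv_eq0 subr_eq0.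
suff -> : 2 / dotv (u - v) (u - v) * dotv (u - v) u = 1.
  by rewrite scale1r opprB addrC subrK.
move: d0; rewrite !dotv_lin (dotvC v u) -uv => d0.
by field; move: d0; apply: contra_neq => <-; ring.
Qed.

End DotProduct.

Lemma dotv_mulmxr {R : realType} {m k} (A : 'M[R]_(m, k)) (x : 'cV[R]_m) u :
  dotv x (A *m u) = dotv (A^T *m x) u.
Proof. by rewrite !dotvE trmx_mul trmxK mulmxA. Qed.

(** * Means of integrable variables *)

Section HasMean.
Context {disp : measure_display} {T : measurableType disp} {R : realType}.
Variable P : probability T R.
Implicit Types f g : T -> R.

(** Integrability and the value of the mean travel together, so that moment
    identities can be composed without separate integrability side conditions. *)
Definition has_mean f m :=
  P.-integrable [set: T] (EFin \o f) /\ 'E_P[f]%E = m%:E.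

Lemma eq_has_mean f g m : f =1 g -> has_mean f m -> has_mean g m.
Proof. by move=> /funext ->. Qed.

Lemma has_meanD f g a b :
  has_mean f a -> has_mean g b -> has_mean (fun w => f w + g w) (a + b).
Proof.
move=> [If Ef] [Ig Eg]; split; first exact: (integrableD measurableT If Ig).
have -> : (fun w => f w + g w) = f \+ g by [].
by rewrite expectationD ?Ef ?Eg//; apply/Lfun1_integrable.
Qed.

Lemma has_meanZ c f a : has_mean f a -> has_mean (fun w => c * f w) (c * a).
Proof.
move=> [If Ef]; split; first exact: (integrableZl measurableT c If).
have -> : (fun w => c * f w) = c \o* f by apply/funext => w /=; rewrite mulrC.
by rewrite expectationZl ?Ef//; apply/Lfun1_integrable.
Qed.

Lemma has_meanB f g a b :
  has_mean f a -> has_mean g b -> has_mean (fun w => f w - g w) (a - b).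
Proof.
move=> hf /(has_meanZ (-1)) hg; rewrite -mulN1r.
by apply: eq_has_mean (has_meanD hf hg) => w; rewrite mulN1r.
Qed.

Lemma has_mean_cst c : has_mean (fun=> c) c.
Proof.
split; last exact: (expectation_cst P c).
exact: (@finite_measure_integrable_cst _ _ _ P).
Qed.

Lemma has_mean_sum (I : finType) (f : I -> T -> R) (a : I -> R) :
  (forall i, has_mean (f i) (a i)) ->
  has_mean (fun w => \sum_i f i w) (\sum_i a i).
Proof.
move=> fa; elim: (index_enum I) => [|i s IH].
  rewrite big_nil; apply: eq_has_mean (has_mean_cst 0) => w.
  by rewrite big_nil.
rewrite big_cons; apply: eq_has_mean (has_meanD (fa i) IH) => w.
by rewrite big_cons.
Qed.

Lemma has_mean_ge0 f : measurable_fun setT f -> (forall w, 0 <= f w) ->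
  ('E_P[f] < +oo)%E -> has_mean f (fine 'E_P[f]%E).
Proof.
move=> mf f0 Ef; have f0' := expectation_ge0 P f0.
split; last by rewrite fineK// ge0_fin_numE.
apply/integrableP; split; first exact/measurable_EFinP.
move: Ef; rewrite unlock; congr (_ < _)%E; apply: eq_integral => w _ /=.
by rewrite ger0_norm.
Qed.

Lemma covariance_has_mean f g a b c : has_mean f a -> has_mean g b ->
  has_mean (fun w => f w * g w) c -> covariance P f g = (c - a * b)%:E.
Proof.
move=> [If Ef] [Ig Eg] [Ifg Efg].
rewrite covarianceE; [|exact/Lfun1_integrable..].
by rewrite Ef Eg (_ : f * g = fun w => f w * g w)// Efg.
Qed.

End HasMean.

(** * Projections of a rotation-invariant vector *)

Lemma measurable_dotv (R : realType) (k : nat) (u : 'cV[R]_k) :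
  measurable_fun setT ((fun z => dotv z u) : borel_cV R k -> R).
Proof.
apply: measurable_sum => i; apply: measurable_funM => //.
apply: (measurability _ (RGenOpens.measurableE R)).
move=> _ [_ [a [b ->] <-]]; rewrite setTI; apply: sub_sigma_algebra.
apply: open_comp; last exact: interval_open.
by move=> z _; exact: coord_continuous.
Qed.

Section RotationInvariant.
Context {disp : measure_display} {T : measurableType disp} {R : realType}.
Variables (P : probability T R) (k : nat) (Z : T -> 'cV[R]_k).
Hypothesis Z_measurable : random_vector Z.
Hypothesis Z_invariant : forall Q : 'M[R]_k, orthogonalmx Q ->
  same_law P (fun w => Q *m Z w) Z.
Implicit Types u v : 'cV[R]_k.

Lemma measurable_proj u : measurable_fun setT (fun w => dotv (Z w) u).
Proof. exact: (measurableT_comp (measurable_dotv u)). Qed.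

(** The Householder reflection taking [u] to [v] is orthogonal and symmetric,
    so that <Q Z, v> = <Z, u>. *)
Lemma proj_same_law u v (B : set R) : dotv u u = dotv v v -> measurable B ->
  P ((fun w => dotv (Z w) u) @^-1` B) = P ((fun w => dotv (Z w) v) @^-1` B).
Proof.
move=> uv mB.
have /(_ ((fun z => dotv z u) @^-1` B)) := Z_invariant (householder_orthogonal (u - v)).
rewrite /preimage /= => <-; last first.
  by rewrite -[X in measurable X]setTI; exact: (measurable_dotv u).
congr (P _); apply/funext => w /=.
by rewrite -{1}(householderT (u - v)) -dotv_mulmxr householder_swap.
Qed.

Lemma proj_integral u v (f : R -> \bar R) : dotv u u = dotv v v ->
  measurable_fun setT f ->
  (\int[P]_w f (dotv (Z w) u) = \int[P]_w f (dotv (Z w) v))%E.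
Proof.
move=> uv; wlog f0 : f / forall x, (0 <= f x)%E => [hw mf|mf].
  rewrite integralE [in RHS]integralE; congr (_ - _)%E.
    have posE (g : T -> R) : (fun w => f (g w))^\+%E = (fun w => f^\+%E (g w)).
      by rewrite unlock.
    by rewrite !posE (hw f^\+%E)//; exact: measurable_funepos.
  have negE (g : T -> R) : (fun w => f (g w))^\-%E = (fun w => f^\-%E (g w)).
    by rewrite unlock.
  by rewrite !negE (hw f^\-%E)//; exact: measurable_funeneg.
pose proj t : {mfun T >-> R} :=
  HB.pack (fun w => dotv (Z w) t) (isMeasurableFun.Build _ _ _ _ _ (measurable_proj t)).
have transfer t : (\int[P]_w f (dotv (Z w) t) = \int[distribution P (proj t)]_x f x)%E.
  by rewrite ge0_integral_distribution.
rewrite !transfer; apply: eq_measure_integral => B mB _; exact: proj_same_law.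
Qed.

Lemma proj_sup_moments u v nu : dotv u u = dotv v v ->
  sup_moments P nu (fun w => dotv (Z w) u) =
  sup_moments P nu (fun w => dotv (Z w) v).
Proof.
move=> uv; rewrite /sup_moments; congr ereal_sup; apply: eq_imagel => q _.
rewrite unlock /=; congr (_ * poweR _ _)%E.
apply: (proj_integral (f := fun x => (`|x%:E| `^ q)%E)) => //.
by apply: (measurableT_comp (measurable_poweR q)); exact: measurableT_comp.
Qed.

Lemma proj_has_mean u v (f : R -> R) m : dotv u u = dotv v v ->
  measurable_fun setT f ->
  has_mean P (fun w => f (dotv (Z w) u)) m ->
  has_mean P (fun w => f (dotv (Z w) v)) m.
Proof.
move=> uv mf [/integrableP[_ If] Ef]; split.
  apply/integrableP; split.
    by apply/measurable_EFinP; exact: (measurableT_comp mf (measurable_proj v)).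
  rewrite -(proj_integral (f := fun x => `|(f x)%:E|)%E uv)//.
  by apply: measurableT_comp => //; exact/measurable_EFinP.
move: Ef; rewrite unlock (proj_integral (f := fun x => (f x)%:E)%E uv)//.
exact/measurable_EFinP.
Qed.

(** <Z, u> and <Z, -u> have the same law. *)
Lemma proj_mean u : P.-integrable [set: T] (fun w => (dotv (Z w) u)%:E) ->
  has_mean P (fun w => dotv (Z w) u) 0.
Proof.
move=> Iu; have Iu' := (Lfun1_integrable P (fun w => dotv (Z w) u)).2 Iu.
have := expectation_fin_num Iu'; case Em : ('E_P[_])%E => [m| |]// _.
have hm : has_mean P (fun w => dotv (Z w) u) m by split.
have hN : has_mean P (fun w => dotv (Z w) (- u)) m.
  by apply: (@proj_has_mean u _ id) => //; rewrite !dotv_lin opprK.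
suff -> : 0 = m by [].
have [_ /eqP] := has_meanD hm hN.
rewrite (_ : (fun w => _ + _) = cst 0); last first.
  by apply/funext => w /=; rewrite dotvNr subrr.
by rewrite expectation_cst eqe => /eqP h; lra.
Qed.

(** With s = |u|, the vector [u] has the same length as s times the [i0]-th
    basis vector; the exponent is even so that s^(2n) = <u, u>^n involves no
    square root. *)
Lemma proj_has_meanX n i0 m u :
  has_mean P (fun w => Z w i0 ord0 ^+ n.*2) m ->
  has_mean P (fun w => dotv (Z w) u ^+ n.*2) (dotv u u ^+ n * m).
Proof.
move=> hm.
have : has_mean P (fun w => dotv (Z w) (Num.sqrt (dotv u u) *: delta_mx i0 ord0) ^+ n.*2)
         (dotv u u ^+ n * m).
  apply: eq_has_mean (has_meanZ (dotv u u ^+ n) hm) => w.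
  by rewrite dotvZr dotv_delta exprMn -mul2n (exprM (Num.sqrt _)) sqr_sqrtr// dotv_ge0.
apply: (proj_has_mean (f := fun x => x ^+ n.*2)) => //.
by rewrite !dotv_lin dotv_delta mxE !eqxx mulr1 -expr2 sqr_sqrtr// dotv_ge0.
Qed.

Section SecondMoment.
Variable i0 : 'I_k.
Hypothesis unit_variance : 'E_P[fun w => (Z w i0 ord0 * Z w i0 ord0)%R]%E = 1%:E.

(** Polarisation: 4 a b = (a + b)^2 - (a - b)^2. *)
Lemma proj_cov_mean u v : has_mean P (fun w => dotv (Z w) u * dotv (Z w) v) (dotv u v).
Proof.
have h1 : has_mean P (fun w => Z w i0 ord0 ^+ 1.*2) 1.
  (* The exponent 1.*2 makes the square convertible to a product. *)
  rewrite (_ : 1 = fine 'E_P[fun w => (Z w i0 ord0 ^+ 1.*2)%R]%E); last by rewrite unit_variance.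
  apply: has_mean_ge0 => [|w|]; [|exact: sqr_ge0|by rewrite unit_variance ltry].
  by apply: measurable_funX; rewrite coord_dotv; exact: measurable_proj.
have h2 x := proj_has_meanX x h1.
have := has_meanZ (4^-1) (has_meanB (h2 (u + v)) (h2 (u - v))).
rewrite !dotv_lin (dotvC v u).
rewrite [X in has_mean _ _ X](_ : _ = dotv u v); last by field.
by apply: eq_has_mean => w; rewrite !dotv_lin; field.
Qed.

(** Integrability holds because |x| <= 1 + x^2. *)
Lemma proj_mean0 u : has_mean P (fun w => dotv (Z w) u) 0.
Proof.
apply: proj_mean.
have [I1 _] := has_meanD (has_mean_cst P 1) (proj_cov_mean u u).
apply: le_integrable I1 => //.
  by apply/measurable_EFinP; exact: measurable_proj.
move=> w _ /=; rewrite lee_fin -expr2.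
set x := dotv _ _; rewrite [leRHS]ger0_norm; last by rewrite addr_ge0 ?sqr_ge0.
by rewrite ler_norml; apply/andP; split; nra.
Qed.

Lemma proj_covariance u v :
  covariance P (fun w => dotv (Z w) u) (fun w => dotv (Z w) v) = (dotv u v)%:E.
Proof.
by rewrite (covariance_has_mean (proj_mean0 u) (proj_mean0 v) (proj_cov_mean u v)) mul0r subr0.
Qed.

End SecondMoment.

Section FourthMoment.
(* For a standard Gaussian vector m = 1. *)
Variables (i0 : 'I_k) (m : R).
Hypothesis fourth_moment : has_mean P (fun w => Z w i0 ord0 ^+ 4) (3 * m).

(** Polarisation of the fourth moments:
    12 a^2 b^2 = (a + b)^4 + (a - b)^4 - 2 a^4 - 2 b^4. The two lemmas that
    follow polarise the squares one at a time by 4 a b = (a + b)^2 - (a - b)^2. *)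
Lemma proj_mean22 u v :
  has_mean P (fun w => dotv (Z w) u ^+ 2 * dotv (Z w) v ^+ 2)
    (m * (dotv u u * dotv v v + 2 * dotv u v ^+ 2)).
Proof.
have h x := proj_has_meanX (n := 2) x fourth_moment.
have := has_meanZ (12^-1) (has_meanB (has_meanD (h (u + v)) (h (u - v)))
  (has_meanZ 2 (has_meanD (h u) (h v)))).
rewrite !dotv_lin (dotvC v u).
rewrite [X in has_mean _ _ X](_ : _ =
  m * (dotv u u * dotv v v + 2 * dotv u v ^+ 2)); last by field.
by apply: eq_has_mean => w; rewrite !dotv_lin; field.
Qed.

Lemma proj_mean112 u v x :
  has_mean P (fun w => dotv (Z w) u * dotv (Z w) v * dotv (Z w) x ^+ 2)
    (m * (dotv u v * dotv x x + 2 * (dotv u x * dotv v x))).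
Proof.
have := has_meanZ (4^-1) (has_meanB (proj_mean22 (u + v) x) (proj_mean22 (u - v) x)).
rewrite !dotv_lin (dotvC v u).
rewrite [X in has_mean _ _ X](_ : _ =
  m * (dotv u v * dotv x x + 2 * (dotv u x * dotv v x))); last by field.
by apply: eq_has_mean => w; rewrite !dotv_lin; field.
Qed.

Lemma proj_mean1111 u v x y :
  has_mean P (fun w => (dotv (Z w) u * dotv (Z w) v) * (dotv (Z w) x * dotv (Z w) y))
    (m * (dotv u v * dotv x y + dotv u x * dotv v y + dotv u y * dotv v x)).
Proof.
have := has_meanZ (4^-1) (has_meanB (proj_mean112 u v (x + y)) (proj_mean112 u v (x - y))).
rewrite !dotv_lin (dotvC y x).
rewrite [X in has_mean _ _ X](_ : _ =
  m * (dotv u v * dotv x y + dotv u x * dotv v y + dotv u y * dotv v x)); last by field.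
by apply: eq_has_mean => w; rewrite !dotv_lin; field.
Qed.

End FourthMoment.

End RotationInvariant.

(** * Symmetric matrices and quadratic forms *)

Lemma sum_mul_delta {R : realType} (I : finType) (f : I -> R) i :
  \sum_j f j * (i == j)%:R = f i.
Proof.
rewrite (bigD1 i)//= eqxx mulr1 big1 ?addr0// => j ji.
by rewrite eq_sym (negbTE ji) mulr0.
Qed.

Section SymmetricMatrices.
Context {R : realType} {d : nat}.
Implicit Types A B : symmx R d.

Lemma symmxT A : (vsval A)^T = vsval A.
Proof. exact/symvP/subvsP. Qed.

Lemma dotSE A B : dotS A B = \sum_i \sum_j vsval A i j * vsval B i j.
Proof.
rewrite /dotS -{2}(symmxT B) /mxtrace; apply: eq_bigr => i _.
by rewrite mxE; apply: eq_bigr => j _; rewrite mxE.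
Qed.

Lemma dotS_ge0 A : 0 <= dotS A A.
Proof.
rewrite dotSE; apply: sumr_ge0 => i _; apply: sumr_ge0 => j _.
by rewrite -expr2 sqr_ge0.
Qed.

Lemma dotS_gt0 A : A != 0 -> 0 < dotS A A.
Proof.
move=> A0; rewrite lt0r dotS_ge0 andbT.
apply: contra_neq A0 => A0; apply/val_inj/matrixP => i j; rewrite mxE.
have row0 l : 0 <= \sum_j vsval A l j * vsval A l j.
  by apply: sumr_ge0 => l' _; rewrite -expr2 sqr_ge0.
have /eqP := A0; rewrite dotSE psumr_eq0// => /allP/(_ i (mem_index_enum _)) /=.
rewrite psumr_eq0 => [|l _]; last by rewrite -expr2 sqr_ge0.
by move=> /allP/(_ j (mem_index_enum _)) /=; rewrite -expr2 sqrf_eq0 => /eqP.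
Qed.

Lemma dotSC A B : dotS A B = dotS B A.
Proof. by rewrite /dotS mxtrace_mulC. Qed.

Lemma dotSDr A B C : dotS A (B + C) = dotS A B + dotS A C.
Proof. by rewrite /dotS [vsval (_ + _)]linearD mulmxDr mxtraceD. Qed.

Lemma dotSZr a A B : dotS A (a *: B) = a * dotS A B.
Proof. by rewrite /dotS [vsval (_ *: _)]linearZ -scalemxAr mxtraceZ. Qed.

(** Cauchy-Schwarz on the diagonal: the variance-like sum of the squares
    (d B_ii - tr B)^2 is nonnegative. *)
Lemma sqr_trace_le A : \tr (vsval A) ^+ 2 <= d%:R * dotS A A.
Proof.
set t := \tr _.
have diag_le : \sum_i vsval A i i ^+ 2 <= dotS A A.
  rewrite dotSE; apply: ler_sum => i _; rewrite (bigD1 i)//= -expr2 lerDl.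
  by apply: sumr_ge0 => j _; rewrite -expr2 sqr_ge0.
have : 0 <= \sum_i (d%:R * vsval A i i - t) ^+ 2.
  by apply: sumr_ge0 => i _; exact: sqr_ge0.
have -> : \sum_i (d%:R * vsval A i i - t) ^+ 2 =
    d%:R * (d%:R * \sum_i vsval A i i ^+ 2 - t ^+ 2).
  transitivity (\sum_i (d%:R ^+ 2 * vsval A i i ^+ 2 + (- (2 * d%:R * t) * vsval A i i + t ^+ 2))).
    by apply: eq_bigr => i _; ring.
  rewrite !big_split /= -!mulr_sumr sumr_const card_ord -/(mxtrace _) -/t -mulr_natl.
  by ring.
have [d0|d0] := posnP d; last first.
  rewrite pmulr_rge0 ?ltr0n// subr_ge0 => /le_trans; apply.
  by rewrite ler_pM2l ?ltr0n.
rewrite (_ : t = 0) => [_|]; last first.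
  by rewrite /t /mxtrace big1// => i; have := ltn_ord i; rewrite {2}d0.
by rewrite expr0n mulr_ge0 ?ler0n ?dotS_ge0.
Qed.

Lemma id_symv : (1%:M : 'M[R]_d) \in symv R d.
Proof. by apply/symvP; rewrite trmx1. Qed.

Definition id_symmx : symmx R d := Subvs id_symv.

Lemma dotS_id A : dotS A id_symmx = \tr (vsval A).
Proof. by rewrite /dotS mulmx1. Qed.

Lemma dotS_outer A (y : 'cV[R]_d) :
  dotS A (outer y) = \sum_i \sum_j vsval A i j * (y i ord0 * y j ord0).
Proof.
rewrite dotSE; apply: eq_bigr => i _; apply: eq_bigr => j _.
by rewrite mxE big_ord1 mxE.
Qed.

Lemma leigenvalueP (K : 'End(symmx R d)) a :
  reflect (exists2 B, B != 0 & K B = a *: B) (passmx.leigenvalue K a).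
Proof.
have eigP B : (B \in passmx.leigenspace K a) = (K B == a *: B).
  by rewrite memv_ker add_lfunE opp_lfunE scale_lfunE id_lfunE subr_eq0.
apply: (iffP idP) => [K0|[B B0 KB]].
  exists (vpick (passmx.leigenspace K a)); first by rewrite vpick0.
  by apply/eqP; rewrite -eigP memv_pick.
apply/negP => /eqP K0; have : B \in passmx.leigenspace K a by rewrite eigP KB.
by rewrite K0 memv0 (negbTE B0).
Qed.

(** This family of operators contains all the covariance operators J_d. *)
Definition pencil (a b : R) B : symmx R d := a *: B + (b * \tr (vsval B)) *: id_symmx.

Lemma pencil_linear a b : linear (pencil a b).
Proof.
move=> c A B; rewrite /pencil [vsval (_ + _)]linearP mxtraceD mxtraceZ !scalerDr !scalerA.
by rewrite mulrDr scalerDl addrACA [a * c]mulrC [b * (c * _)]mulrCA.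
Qed.

End SymmetricMatrices.

Section Covop.
Context {disp : measure_display} {T : measurableType disp} {R : realType}.
Variables (P : probability T R) (d : nat).

(** [covop] picks some operator with the defining property, so it suffices to
    exhibit one. *)
Lemma covopP (W : T -> symmx R d) K : is_covop P W K -> is_covop P W (covop P W).
Proof. by move=> hK; apply: (xgetPex 0 (P := [set K | is_covop P W K])); exists K. Qed.

End Covop.

Section QuadraticForms.
Context {disp : measure_display} {T : measurableType disp} {R : realType}.
Variables (P : probability T R) (d : nat) (y : T -> 'cV[R]_d).
Variable m : R.
(* These are the moments of the coordinates of a rotation-invariant vector in an
   orthonormal family. *)
Hypothesis y2 : forall i j, has_mean P (fun w => y w i ord0 * y w j ord0) (i == j)%:R.
Hypothesis y4 : forall i j k l,
  has_mean P (fun w => (y w i ord0 * y w j ord0) * (y w k ord0 * y w l ord0))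
    (m * ((i == j)%:R * (k == l)%:R + (i == k)%:R * (j == l)%:R + (i == l)%:R * (j == k)%:R)).
Implicit Types A B : symmx R d.

Lemma quadratic_mean A : has_mean P (fun w => dotS A (outer (y w))) (\tr (vsval A)).
Proof.
have -> : \tr (vsval A) = \sum_i \sum_j vsval A i j * (i == j)%:R.
  by apply: eq_bigr => i _; rewrite sum_mul_delta.
have := has_mean_sum (fun i => has_mean_sum (fun j => has_meanZ (vsval A i j) (y2 i j))).
by apply: eq_has_mean => w; rewrite dotS_outer.
Qed.

Lemma quadratic_product_mean A B :
  has_mean P (fun w => dotS A (outer (y w)) * dotS B (outer (y w)))
    (m * (\tr (vsval A) * \tr (vsval B) + 2 * dotS A B)).
Proof.
(* Each entry y_i y_j is treated first, so that only one double sum of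
   Kronecker deltas has to be collapsed at a time. *)
have hB i j : has_mean P (fun w => (y w i ord0 * y w j ord0) * dotS B (outer (y w)))
    (m * ((i == j)%:R * \tr (vsval B) + 2 * vsval B i j)).
  have := has_mean_sum (fun k => has_mean_sum (fun l =>
    has_meanZ (vsval B k l) (y4 i j k l))).
  rewrite [X in has_mean _ _ X](_ : _ = m * ((i == j)%:R * \tr (vsval B) + 2 * vsval B i j)).
    apply: eq_has_mean => w; rewrite dotS_outer mulr_sumr; apply: eq_bigr => k _.
    by rewrite mulr_sumr; apply: eq_bigr => l _; ring.
  transitivity (m * ((i == j)%:R * (\sum_k \sum_l vsval B k l * (k == l)%:R)
    + ((\sum_k (\sum_l vsval B k l * (j == l)%:R) * (i == k)%:R)
      + (\sum_k (\sum_l vsval B k l * (i == l)%:R) * (j == k)%:R)))).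
    rewrite [X in m * (X + _)]mulr_sumr -!big_split mulr_sumr; apply: eq_bigr => k _ /=.
    rewrite !mulr_suml mulr_sumr -!big_split mulr_sumr; apply: eq_bigr => l _ /=.
    by ring.
  have B_sym : vsval B j i = vsval B i j by rewrite -{1}(symmxT B) mxE.
  rewrite !sum_mul_delta B_sym; congr (m * (_ * _ + _)); last by ring.
  by apply: eq_bigr => k _; rewrite sum_mul_delta.
have := has_mean_sum (fun i => has_mean_sum (fun j => has_meanZ (vsval A i j) (hB i j))).
rewrite [X in has_mean _ _ X](_ : _ = m * (\tr (vsval A) * \tr (vsval B) + 2 * dotS A B)).
  apply: eq_has_mean => w; rewrite (dotS_outer A) mulr_suml; apply: eq_bigr => i _.
  by rewrite mulr_suml; apply: eq_bigr => j _; ring.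
transitivity (m * ((\sum_i (\sum_j vsval A i j * (i == j)%:R)) * \tr (vsval B) + 2 * dotS A B)).
  rewrite dotSE mulr_suml mulr_sumr -big_split mulr_sumr; apply: eq_bigr => i _ /=.
  rewrite mulr_suml mulr_sumr -big_split mulr_sumr; apply: eq_bigr => j _ /=.
  by ring.
by congr (m * (_ * _ + _)); apply: eq_bigr => i _; rewrite sum_mul_delta.
Qed.

Lemma quadratic_covariance A B :
  covariance P (fun w => dotS A (outer (y w))) (fun w => dotS B (outer (y w))) =
  (2 * m * dotS A B + (m - 1) * \tr (vsval A) * \tr (vsval B))%:E.
Proof.
rewrite (covariance_has_mean (quadratic_mean A) (quadratic_mean B) (quadratic_product_mean A B)).
by congr (_%:E); ring.
Qed.

Lemma outer_is_covop : is_covop P (fun w => outer (y w)) (covop P (fun w => outer (y w))).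
Proof.
pose K : {linear symmx R d -> symmx R d} :=
  HB.pack (pencil (2 * m) (m - 1)) (GRing.isLinear.Build R _ _ _ _ (@pencil_linear R d _ _)).
apply: (@covopP _ _ _ _ _ _ (linfun K)) => A B.
by rewrite quadratic_covariance lfunE /= /pencil dotSDr !dotSZr dotS_id; congr (_%:E); ring.
Qed.

Lemma covop_eigenvalue a : passmx.leigenvalue (covop P (fun w => outer (y w))) a ->
  exists2 B : symmx R d, B != 0 & a * dotS B B = 2 * m * dotS B B + (m - 1) * \tr (vsval B) ^+ 2.
Proof.
move=> /leigenvalueP[B B0 KB]; exists B => //.
have := outer_is_covop B B; rewrite quadratic_covariance KB dotSZr => -[->]; ring.
Qed.

End QuadraticForms.

(** * Eigenvalue bounds *)

(** Here [k] is the dimension, [v] the variance of |Z|^2, [a] an eigenvalue,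
    [s] the squared norm of its eigenvector and [t2] the square of the trace.
    The point is that [a] is a convex combination of [2 * m], which lies between
    2 / 3 and 2 (1 + c2), and [v / k], which lies between 1 / c1 and c2;
    1 / (2 + c1) is below both 2 / 3 and 1 / c1. *)
Lemma rotation_eigenvalue_bounds (R : realType) (k m v a s t2 c1 c2 : R) :
  1 <= k -> 0 < c1 -> 0 < c2 -> k <= c1 * v -> v <= c2 * k ->
  v = 2 * m * k + (m - 1) * k ^+ 2 ->
  0 < s -> 0 <= t2 -> t2 <= k * s -> a * s = 2 * m * s + (m - 1) * t2 ->
  1 <= (2 + c1) * a /\ a <= 2 * (1 + c2).
Proof.
move=> k1 c1_gt0 c2_gt0 kv vk vE s0 t20 t2s aE.
have k0 : 0 < k by lra.
have v0 : 0 < v by rewrite -(pmulr_rgt0 _ c1_gt0); lra.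
have mE : m * (k ^+ 2 + 2 * k) = v + k ^+ 2 by rewrite vE; ring.
have kk0 : 0 < k ^+ 2 + 2 * k by nra.
have m_ge : 1 <= 3 * m by rewrite -(ler_pM2r kk0); nra.
have m_le : m <= 1 + c2 by rewrite -(ler_pM2r kk0); nra.
(* Eliminating m - 1 through the formula for v. *)
have convex : a * (s * k ^+ 2) = 2 * m * k * (k * s - t2) + v * t2.
  by rewrite mulrA aE vE; ring.
have sk0 : 0 < s * k ^+ 2 by rewrite mulr_gt0// exprn_gt0.
have kst0 : 0 <= k * (k * s - t2) by rewrite mulr_ge0 ?subr_ge0// ltW.
split.
- rewrite -(ler_pM2r sk0) mul1r -mulrA convex.
  have h1 : 1 * (k * (k * s - t2)) <= (2 + c1) * (2 * m) * (k * (k * s - t2)).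
    by apply: ler_wpM2r => //; nra.
  have h2 : k * t2 <= (2 + c1) * v * t2 by apply: ler_wpM2r => //; nra.
  by lra.
- rewrite -(ler_pM2r sk0) convex.
  have h1 : 2 * m * (k * (k * s - t2)) <= 2 * (1 + c2) * (k * (k * s - t2)).
    by apply: ler_wpM2r => //; lra.
  have h2 : v * t2 <= 2 * (1 + c2) * k * t2 by apply: ler_wpM2r => //; nra.
  by lra.
Qed.

Lemma leigenvalue_symmx1 (R : realType) (K : 'End(symmx R 1)) :
  exists a, passmx.leigenvalue K a.
Proof.
exists (vsval (K id_symmx) ord0 ord0); apply/leigenvalueP; exists id_symmx.
  apply/negP => /eqP/(congr1 vsval)/matrixP/(_ ord0 ord0)/eqP.
  by rewrite !mxE eqxx oner_eq0.
apply/val_inj/matrixP => i j; rewrite !ord1 [X in _ = fun_of_matrix X _ _]linearZ.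
by rewrite !mxE eqxx mulr1.
Qed.

(** Symmetric 1 x 1 matrices form a line, so J_1 has an eigenvalue even when the
    second moments are infinite; it separates the two bounds. *)
Lemma inf_lambda_min_le_sup_lambda_max (disp : measure_display)
    (T : measurableType disp) (R : realType) (P : probability T R) (k : nat)
    (X : T -> 'cV[R]_k) (phi : 'I_k -> 'cV[R]_k) : (0 < k)%N ->
  (inf_lambda_min P X phi <= sup_lambda_max P X phi)%E.
Proof.
move=> k0; have [a Ka] := leigenvalue_symmx1 (Jop P X phi k0).
apply: (@le_trans _ _ (lambda_min (Jop P X phi k0))).
  by apply: ereal_inf_lbound; exists 1%N, k0.
apply: (@le_trans _ _ (lambda_max (Jop P X phi k0))).
  apply: (@le_trans _ _ a%:E); first by apply: ereal_inf_lbound; exists a.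
  by apply: ereal_sup_ubound; exists a.
by apply: ereal_sup_ubound; exists 1%N, k0.
Qed.

(** * The elliptical model *)

Section EllipticalModel.
Context {disp : measure_display} {T : measurableType disp} {R : realType}.
Variables (P : probability T R) (k : nat) (Z : T -> 'cV[R]_k).
Hypothesis Z_measurable : random_vector Z.
Hypothesis Z_invariant : forall Q : 'M[R]_k, orthogonalmx Q ->
  same_law P (fun w => Q *m Z w) Z.
Variable i0 : 'I_k.
Hypothesis unit_variance : 'E_P[fun w => (Z w i0 ord0 * Z w i0 ord0)%R]%E = 1%:E.

Let cov_mean := proj_cov_mean Z_measurable Z_invariant unit_variance.

Lemma proj_Lnorm2 u :
  ('N[P]_(2%:E) [EFin \o (fun w => dotv (Z w) u)])%E = (Num.sqrt (dotv u u))%:E.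
Proof.
rewrite unlock; have [_] := cov_mean u u; rewrite unlock => cov_u.
rewrite (eq_integral (fun w => (dotv (Z w) u * dotv (Z w) u)%:E)).
  by rewrite cov_u poweR_EFin powR12_sqrt// dotv_ge0.
by move=> w _ /=; rewrite -expr2 powR_mulrn// real_normK// num_real.
Qed.

Section Whitening.
Variables (M Sigma : 'M[R]_k) (X : T -> 'cV[R]_k).
Variables (lam : 'I_k -> R) (phi : 'I_k -> 'cV[R]_k).
Hypothesis XE : forall w, X w = M *m Z w.
Hypothesis SigmaE : Sigma = covmx P X.
Hypothesis Sigma_pd : pdmx Sigma.
Hypothesis Sigma_spectral :
  Sigma = \sum_(j < k) lam j *: (phi j *m (phi j)^T).
Hypothesis phi_orthonormal : forall i j, dotv (phi i) (phi j) = (i == j)%:R.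

(** The centring terms vanish because <Z, u> has mean 0. *)
Lemma covmx_linear : Sigma = M *m M^T.
Proof.
apply/matrixP => i j; rewrite SigmaE mxE.
have XiE l : (fun w => X w l ord0) = (fun w => dotv (Z w) (col l M^T)).
  apply/funext => w; rewrite XE mxE; apply: eq_bigr => l' _.
  by rewrite !mxE mulrC.
rewrite !XiE (proj_covariance Z_measurable Z_invariant unit_variance) /= mxE.
by apply: eq_bigr => l _; rewrite !mxE.
Qed.

Lemma Sigma_form i j : dotv (phi i) (Sigma *m phi j) = lam j * (i == j)%:R.
Proof.
have -> : Sigma *m phi j = lam j *: phi j.
  rewrite Sigma_spectral mulmx_suml (bigD1 j)//= big1 => [|l lj].
    rewrite addr0 -scalemxAl -mulmxA [(phi j)^T *m _]mx11_scalar -dotvE.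
    by rewrite phi_orthonormal eqxx mulmx1.
  rewrite -scalemxAl -mulmxA [(phi l)^T *m _]mx11_scalar -dotvE phi_orthonormal.
  by rewrite (negbTE lj) mul_mx_scalar scale0r scaler0.
by rewrite dotvZr phi_orthonormal.
Qed.

Lemma lam_gt0 j : 0 < lam j.
Proof.
have := Sigma_pd.2 (phi j); rewrite Sigma_form eqxx mulr1; apply.
by rewrite -dotv_eq0 phi_orthonormal eqxx oner_eq0.
Qed.

(** <X, phi_j> = <Z, M^T phi_j>, and the squared length lambda_j of M^T phi_j is
    the second moment that normalises zeta_j. *)
Lemma zeta_whitening : exists e : 'I_k -> 'cV[R]_k,
  (forall i j, dotv (e i) (e j) = (i == j)%:R) /\
  (forall j w, zeta P X phi j w = dotv (Z w) (e j)).
Proof.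
have form i j : dotv (M^T *m phi i) (M^T *m phi j) = lam j * (i == j)%:R.
  by rewrite -Sigma_form covmx_linear -mulmxA [RHS]dotv_mulmxr.
exists (fun j => (Num.sqrt (lam j))^-1 *: (M^T *m phi j)); split=> [i j|j w].
  rewrite dotvZl dotvZr form; have [->|ij] := eqVneq; last by rewrite !mulr0.
  have s0 : Num.sqrt (lam j) != 0 by rewrite sqrtr_eq0 -ltNge lam_gt0.
  rewrite mulr1 -[X in _ * (_ * X)](sqr_sqrtr (ltW (lam_gt0 j))).
  by rewrite mulr1n; field.
have projE w' : dotv (X w') (phi j) = dotv (Z w') (M^T *m phi j).
  by rewrite XE dotvC dotv_mulmxr dotvC.
rewrite /zeta (_ : (fun w' => _) = (fun w' => dotv (Z w') (M^T *m phi j))); last exact/funext.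
by rewrite proj_Lnorm2 form eqxx mulr1 dotvZr projE mulrC.
Qed.

End Whitening.

Lemma sqr_norm2 (v : 'cV[R]_k) : norm2 v ^+ 2 = dotv v v.
Proof. by rewrite sqr_sqrtr// dotv_ge0. Qed.

Lemma sqr_norm2_mean : has_mean P (fun w => norm2 (Z w) ^+ 2) k%:R.
Proof.
have := has_mean_sum (fun i => cov_mean (delta_mx i ord0) (delta_mx i ord0)).
rewrite (eq_bigr (fun=> 1)) => [|i _]; last by rewrite dotv_delta mxE !eqxx.
rewrite sumr_const card_ord; apply: eq_has_mean => w.
by rewrite sqr_norm2; apply: eq_bigr => i _; rewrite dotv_delta.
Qed.

(** A finite variance controls the fourth moment, since with N = |Z|^2
    Z_1^4 <= N^2 <= 2 (N - k)^2 + 2 k^2. *)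
Lemma fourth_moment_of_variance :
  ('V_P[fun w => (norm2 (Z w) ^+ 2)%R] < +oo)%E ->
  exists m, has_mean P (fun w => Z w i0 ord0 ^+ 4) (3 * m).
Proof.
move=> V_fin; set N := fun w => (norm2 (Z w) ^+ 2)%R in V_fin.
have mN : measurable_fun setT N.
  by have [/measurable_int/measurable_EFinP] := sqr_norm2_mean.
have mZ : measurable_fun setT (fun w => Z w i0 ord0).
  by rewrite coord_dotv; exact: measurable_proj.
have VE : 'V_P[N]%E = 'E_P[fun w => ((N w - k%:R) ^+ 2)%R]%E.
  by rewrite /variance covariance.unlock sqr_norm2_mean.2 /=; congr expectation.
have hdev : has_mean P (fun w => (N w - k%:R) ^+ 2) (fine 'V_P[N]%E).
  rewrite VE; apply: has_mean_ge0 => [|w|]; [|exact: sqr_ge0|by rewrite -VE].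
  by apply: measurable_funX; exact: measurable_funB.
have [Idom _] := has_meanD (has_meanZ 2 hdev) (has_mean_cst P (2 * k%:R ^+ 2)).
have I4 : P.-integrable setT (EFin \o (fun w => Z w i0 ord0 ^+ 4)).
  apply: le_integrable Idom => //.
    by apply/measurable_EFinP; exact: measurable_funX.
  move=> w _ /=; rewrite lee_fin.
  have coord_le : Z w i0 ord0 ^+ 2 <= N w.
    rewrite /N sqr_norm2 /dotv (bigD1 i0)//= -expr2 lerDl.
    by apply: sumr_ge0 => i _; rewrite -expr2 sqr_ge0.
  rewrite !ger0_norm.
  - have := ler_pM (sqr_ge0 _) (sqr_ge0 _) coord_le coord_le.
    by have := sqr_ge0 (N w - 2 * k%:R); nra.
  - by rewrite addr_ge0// mulr_ge0 ?sqr_ge0.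
  - by rewrite (exprM _ 2 2) sqr_ge0.
have := expectation_fin_num ((Lfun1_integrable _ _).2 I4).
case E4 : ('E_P[_])%E => [r| |]// _; exists (r / 3).
by rewrite mulrC divfK//; split.
Qed.

Section OrthonormalCoordinates.
Variables (d : nat) (e : 'I_d -> 'cV[R]_k).
Hypothesis e_orthonormal : forall i j, dotv (e i) (e j) = (i == j)%:R.
Let y w : 'cV[R]_d := \col_i dotv (Z w) (e i).

Lemma orthonormal_coord_mean2 i j :
  has_mean P (fun w => y w i ord0 * y w j ord0) (i == j)%:R.
Proof.
rewrite -e_orthonormal; apply: eq_has_mean (cov_mean (e i) (e j)) => w.
by rewrite !mxE.
Qed.

Lemma orthonormal_coord_mean4 m i j l n :
  has_mean P (fun w => Z w i0 ord0 ^+ 4) (3 * m) ->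
  has_mean P (fun w => (y w i ord0 * y w j ord0) * (y w l ord0 * y w n ord0))
    (m * ((i == j)%:R * (l == n)%:R + (i == l)%:R * (j == n)%:R + (i == n)%:R * (j == l)%:R)).
Proof.
move=> h4; have := proj_mean1111 Z_measurable Z_invariant h4 (e i) (e j) (e l) (e n).
by rewrite !e_orthonormal; apply: eq_has_mean => w; rewrite !mxE.
Qed.

End OrthonormalCoordinates.

(** |Z|^2 is the quadratic form of the identity matrix in the standard
    coordinates. *)
Lemma sqr_norm2_variance m : has_mean P (fun w => Z w i0 ord0 ^+ 4) (3 * m) ->
  'V_P[fun w => (norm2 (Z w) ^+ 2)%R]%E = (2 * m * k%:R + (m - 1) * k%:R ^+ 2)%:E.
Proof.
move=> h4; pose e (i : 'I_k) : 'cV[R]_k := delta_mx i ord0.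
have e_on i j : dotv (e i) (e j) = (i == j)%:R.
  by rewrite dotv_delta mxE eqxx andbT eq_sym.
have := quadratic_covariance (orthonormal_coord_mean2 e_on)
  (fun i j l n => orthonormal_coord_mean4 e_on i j l n h4) id_symmx id_symmx.
have ZE w : \col_i dotv (Z w) (e i) = Z w.
  by apply/matrixP => i j; rewrite mxE dotv_delta (ord1 j).
rewrite dotS_id mxtrace1.
have -> : (fun w => dotS id_symmx (outer (\col_i dotv (Z w) (e i)))) =
    (fun w => norm2 (Z w) ^+ 2).
  apply/funext => w; rewrite ZE sqr_norm2 dotSC dotS_id mxtrace_mulC dotvE.
  by rewrite /mxtrace big_ord1.
by rewrite /variance => ->; congr (_%:E); ring.
Qed.

(** The bounds depend neither on [d] nor on [k], only on the constants that
    compare the variance and the mean of |Z|^2. *)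
Lemma outer_eigenvalue_bounds (d : nat) (e : 'I_d -> 'cV[R]_k) (c1 c2 a : R) :
  (d <= k)%N -> (forall i j, dotv (e i) (e j) = (i == j)%:R) ->
  0 < c1 -> 0 < c2 ->
  ('E_P[fun w => (norm2 (Z w) ^+ 2)%R] <= c1%:E * 'V_P[fun w => (norm2 (Z w) ^+ 2)%R])%E ->
  ('V_P[fun w => (norm2 (Z w) ^+ 2)%R] <= c2%:E * 'E_P[fun w => (norm2 (Z w) ^+ 2)%R])%E ->
  passmx.leigenvalue (covop P (fun w => outer (\col_i dotv (Z w) (e i)))) a ->
  1 <= (2 + c1) * a /\ a <= 2 * (1 + c2).
Proof.
move=> dk e_on c1_gt0 c2_gt0.
rewrite sqr_norm2_mean.2 => EV VE.
have V_fin : ('V_P[fun w => (norm2 (Z w) ^+ 2)%R] < +oo)%E.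
  by apply: le_lt_trans VE _; rewrite -EFinM ltry.
have [m h4] := fourth_moment_of_variance V_fin.
move: EV VE; rewrite (sqr_norm2_variance h4) -!EFinM !lee_fin => EV VE.
move=> /(covop_eigenvalue (orthonormal_coord_mean2 e_on)
  (fun i j l n => orthonormal_coord_mean4 e_on i j l n h4))[B B0 aE].
have s0 := dotS_gt0 B0.
apply: (rotation_eigenvalue_bounds (k := k%:R) (s := dotS B B) _ _ _ EV VE _ _ _ _ aE) => //.
- by rewrite ler1n (leq_ltn_trans _ (ltn_ord i0)).
- exact: sqr_ge0.
- by apply: le_trans (sqr_trace_le B) _; rewrite ler_pM2r// ler_nat.
Qed.

End EllipticalModel.

Theorem proposition3p1 (R : realType)
  (disp : nat -> measure_display) (Omega : forall n, measurableType (disp n))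
  (P : forall n, probability (Omega n) R)
  (p : nat -> nat) (p_gt0 : forall n, (0 < p n)%N)
  (M : forall n, 'M[R]_(p n)) (Z X : forall n, Omega n -> 'cV[R]_(p n))
  (Sigma : forall n, 'M[R]_(p n))
  (lam : forall n, 'I_(p n) -> R) (phi : forall n, 'I_(p n) -> 'cV[R]_(p n))
  (hM : forall n, psdmx (M n))
  (hZ : forall n, random_vector (Z n))
  (hcov : forall n (i j : 'I_(p n)),
    'E_(P n)[fun w => (Z n w i ord0 * Z n w j ord0)%R]%E = ((i == j)%:R)%:E)
  (hinv : forall n (Q : 'M[R]_(p n)), orthogonalmx Q ->
    same_law (P n) (fun w => Q *m Z n w) (Z n))
  (hX : forall n w, X n w = M n *m Z n w)
  (hSigma : forall n, Sigma n = covmx (P n) (X n))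
  (hSigma_pd : forall n, pdmx (Sigma n))
  (hspec : forall n,
    Sigma n = \sum_(j < p n) lam n j *: (phi n j *m (phi n j)^T))
  (hlam : forall n (i j : 'I_(p n)), (i <= j)%N -> lam n j <= lam n i)
  (hphi : forall n (i j : 'I_(p n)), dotv (phi n i) (phi n j) = (i == j)%:R) :
  (forall nu : R, 0 < nu ->
     lesssim
       (fun n => sup_moments (P n) nu
                   (fun w => Z n w (Ordinal (p_gt0 n)) ord0))
       (fun=> 1%E) ->
     exists nu' : R, 0 < nu' /\
       lesssim
         (fun n => ereal_sup
            [set sup_moments (P n) nu' (zeta (P n) (X n) (phi n) j)
            | j in [set: 'I_(p n)]])
         (fun=> 1%E))
  /\
  ((forall n, P n (Z n @^-1` [set 0]) = 0%E) ->
   asymp_eq (fun n => 'V_(P n)[fun w => (norm2 (Z n w) ^+ 2)%R]%E)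
            (fun n => 'E_(P n)[fun w => (norm2 (Z n w) ^+ 2)%R]%E) ->
   [/\ lesssim (fun=> 1%E)
         (fun n => inf_lambda_min (P n) (X n) (phi n)),
       forall n, (inf_lambda_min (P n) (X n) (phi n)
                  <= sup_lambda_max (P n) (X n) (phi n))%E
     & lesssim (fun n => sup_lambda_max (P n) (X n) (phi n))
         (fun=> 1%E)]).
Proof.
pose i0 n := Ordinal (p_gt0 n).
have uvar n : 'E_(P n)[fun w => (Z n w (i0 n) ord0 * Z n w (i0 n) ord0)%R]%E = 1%:E.
  by rewrite hcov eqxx.
have whiten n := zeta_whitening (hZ n) (@hinv n) (uvar n) (hX n) (hSigma n)
  (hSigma_pd n) (hspec n) (@hphi n).
split=> [nu nu0 [c [c0 hc]]|_ [[c2 [c2_gt0 VE]] [c1 [c1_gt0 EV]]]].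
  exists nu; split=> //; exists c; split=> //.
  apply: filterS hc => n; apply: le_trans.
  apply: ge_ereal_sup => _ [j _ <-].
  have [e [e_on zetaE]] := whiten n.
  rewrite (_ : zeta _ _ _ j = (fun w => dotv (Z n w) (e j))); last exact/funext.
  rewrite (proj_sup_moments (hZ n) (@hinv n) (v := delta_mx (i0 n) ord0)).
    by rewrite -coord_dotv.
  by rewrite e_on dotv_delta mxE !eqxx.
have JE n : exists e : 'I_(p n) -> 'cV[R]_(p n),
    (forall i j, dotv (e i) (e j) = (i == j)%:R) /\
    forall d (hd : (d <= p n)%N), Jop (P n) (X n) (phi n) hd =
      covop (P n) (fun w => outer (\col_i dotv (Z n w) (e (widen_ord hd i)))).
  have [e [e_on zetaE]] := whiten n; exists e; split=> // d hd.
  rewrite /Jop; congr covop; apply/funext => w; congr outer.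
  by apply/matrixP => i j; rewrite !mxE zetaE.
have bounds : \forall n \near \oo, forall d (hd : (d <= p n)%N) a,
    passmx.leigenvalue (Jop (P n) (X n) (phi n) hd) a ->
    1 <= (2 + c1) * a /\ a <= 2 * (1 + c2).
  apply: filterS2 EV VE => n EV VE d hd a; have [e [e_on ->]] := JE n.
  by apply: (outer_eigenvalue_bounds (hZ n) (@hinv n) (uvar n)) => // i j; rewrite e_on.
have c1' : 0 < 2 + c1 by lra.
have c2' : 0 < 2 * (1 + c2) by lra.
split=> [|n|]; last 2 [|].
- exists (2 + c1); split=> //; apply: filterS bounds => n bounds.
  rewrite -lee_pdivrMl// mule1; apply: le_ereal_inf_tmp => _ [d [hd [_ ->]]].
  apply: le_ereal_inf_tmp => _ [a /bounds[a_ge _] <-].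
  by rewrite lee_fin -[leLHS]mulr1 ler_pdivrMl.
- exact: inf_lambda_min_le_sup_lambda_max.
- exists (2 * (1 + c2)); split=> //; apply: filterS bounds => n bounds.
  rewrite mule1; apply: ge_ereal_sup => _ [d [hd [_ ->]]].
  apply: ge_ereal_sup => _ [a /bounds[_ a_le] <-].
  by rewrite lee_fin.
Qed.
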